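(* Suppose $\gamma:\mathbb{R}^2\to\mathbb{R}^{2,1}$ is a smooth space-like solution of the $\ast$-MCF $\gamma_t=-\frac12\ast_\gamma H(\gamma)$ on $\mathbb{R}^{2,1}$, parametrized by arc-length ($\langle\gamma_x,\gamma_x\rangle=1$). Then there is a smooth $g=(e_0,e_1,e_2):\mathbb{R}^2\to O(3,D_3)$ such that (i) $g(\cdot,t)$ is a null p-frame along $\gamma(\cdot,t)$ for all $t$, and $$g^{-1}g_x=\begin{pmatrix}0&-\frac{k_2}{2}&-\frac{k_1}{2}\\k_1&0&0\\k_2&0&0\end{pmatrix},\qquad g^{-1}g_t=\frac14\begin{pmatrix}0&-(k_2)_x&(k_1)_x\\-2(k_1)_x&k_1k_2&0\\2(k_2)_x&0&-k_1k_2\end{pmatrix};$$ (ii) $q=-\frac{k_1}{2}$ and $r=\frac{k_2}{2}$ satisfy the second flow of the $SL(2,\mathbb{R})$-hierarchy, i.e. $$q_t=-\tfrac12(q_{xx}-2q^2r),\qquad r_t=\tfrac12(r_{xx}-2qr^2).$$ Moreover, if $\tilde g:\mathbb{R}^2\to O(3,D_3)$ also satisfies (i) and (ii), then there is a constant $c\in\mathbb{R}\setminus\{0\}$ such that $\tilde g=g\,\mathrm{diag}(1,c,c^{-1})$, and the corresponding null principal curvatures are related by $\tilde k_1=c^{-1}k_1$ and $\tilde k_2=ck_2$.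
   Context: $\mathbb{R}^{2,1}$ is $\mathbb{R}^3$ with the bilinear form $\langle v,w\rangle=v^tD_3w$, where $D_3=\begin{pmatrix}1&0&0\\0&0&\frac12\\0&\frac12&0\end{pmatrix}$, so $\langle v,v\rangle=v_1^2+v_2v_3$ (equivalently $sl(2,\mathbb{R})$ with $\frac12\mathrm{tr}(XY)$ and ordered basis $\mathrm{diag}(1,-1),e_{12},e_{21}$). $O(3,D_3)=\{A\in GL(3,\mathbb{R}):A^tD_3A=D_3\}$; frames are taken positively oriented, i.e. with determinant $1$. For a space-like curve with $\langle\gamma_x,\gamma_x\rangle=1$, a null p-frame is $g=(e_0,e_1,e_2)$ with values in $O(3,D_3)$ (determinant $1$), $e_0=\gamma_x$, and $g^{-1}g_x$ of the form displayed in (i); so $e_1,e_2$ are null normal fields with $\langle e_1,e_2\rangle=\frac12$, parallel in the normal bundle, and $k_1,k_2$ are the null principal curvatures along $e_1,e_2$. The mean curvature vector is $H(\gamma)=\gamma_{xx}=k_1e_1+k_2e_2$. The Hodge star operator $\ast_\gamma$ on the Lorentzian normal plane is the linear map with $\ast_\gamma e_1=e_1$, $\ast_\gamma e_2=-e_2$ for every such frame. *)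

(* Defs.v *)
From mathcomp Require Import all_boot all_order all_algebra.
From mathcomp Require Import all_classical all_reals all_analysis.
Import Order.TTheory GRing.Theory Num.Theory numFieldNormedType.Exports.

Set Implicit Arguments.
Unset Strict Implicit.
Unset Printing Implicit Defensive.

Local Open Scope ring_scope.

Definition partial_x (R : realType) (V : normedModType R) (f : R -> R -> V) :
  R -> R -> V := fun x t => derive1 (f^~ t) x.

Definition partial_t (R : realType) (V : normedModType R) (f : R -> R -> V) :
  R -> R -> V := fun x t => derive1 (f x) t.

(* Class C^n on R^2; continuity is joint continuity in (x, t). *)
Fixpoint class_C (R : realType) (V : normedModType R) (n : nat)
    (f : R -> R -> V) : Prop :=
  match n with
  | 0 => continuous (fun p : R * R => f p.1 p.2)
  | n'.+1 =>
      [/\ forall x t, derivable (f^~ t) x 1,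
          forall x t, derivable (f x) t 1,
          class_C n' (partial_x f)
        & class_C n' (partial_t f)]
  end.

Definition smooth (R : realType) (V : normedModType R) (f : R -> R -> V) :=
  forall n, class_C n f.

Definition mx3 (R : realType) (rows : seq (seq R)) : 'M[R]_3 :=
  \matrix_(i < 3, j < 3) nth 0 (nth [::] rows i) j.

Definition D3 (R : realType) : 'M[R]_3 :=
  mx3 [:: [:: 1; 0;    0   ];
          [:: 0; 0;    2^-1];
          [:: 0; 2^-1; 0   ]].

Definition form21 (R : realType) (v w : 'cV[R]_3) : R :=
  (v^T *m D3 R *m w) 0 0.

Definition in_O3D3 (R : realType) (A : 'M[R]_3) : Prop :=
  A \in unitmx /\ A^T *m D3 R *m A = D3 R.

(* The columns 0, 1, 2 of g are e_0, e_1, e_2. *)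
Definition null_p_frame (R : realType) (alpha : R -> 'cV[R]_3)
    (g : R -> 'M[R]_3) (k1 k2 : R -> R) : Prop :=
  forall x,
    [/\ in_O3D3 (g x) /\ \det (g x) = 1,
        col 0 (g x) = derive1 alpha x,
        derivable g x 1
      & invmx (g x) *m derive1 g x =
        mx3 [:: [:: 0;    - (k2 x / 2); - (k1 x / 2)];
                [:: k1 x; 0;            0           ];
                [:: k2 x; 0;            0           ]]].

Definition mean_curvature (R : realType) (alpha : R -> 'cV[R]_3) (x : R) :
  'cV[R]_3 := derive1 (derive1 alpha) x.

(* The star operator only acts on the normal plane; its matrix on R^3 is
   normalized by sending the tangent vector to 0. *)
Definition is_hodge_star (R : realType) (alpha : R -> 'cV[R]_3) (x : R)
    (S : 'M[R]_3) : Prop :=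
  S *m derive1 alpha x = 0 /\
  forall (g : R -> 'M[R]_3) (k1 k2 : R -> R), null_p_frame alpha g k1 k2 ->
    S *m col 1 (g x) = col 1 (g x) /\ S *m col 2 (g x) = - col 2 (g x).

(* Along a smooth curve with <alpha_x, alpha_x> = 1 exactly one S satisfies
   [is_hodge_star]: null p-frames exist, and two of them (both of
   determinant 1) differ by right multiplication by some diag(1, c, c^-1). *)
Definition hodge_star (R : realType) (alpha : R -> 'cV[R]_3) (x : R) :
  'M[R]_3 := get (is_hodge_star alpha x).

Definition star_MCF (R : realType) (gamma : R -> R -> 'cV[R]_3) : Prop :=
  forall x t, partial_t gamma x t =
    - 2^-1 *: (hodge_star (gamma^~ t) x *m mean_curvature (gamma^~ t) x).

Definition evolving_frame (R : realType) (gamma : R -> R -> 'cV[R]_3)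
    (g : R -> R -> 'M[R]_3) (k1 k2 : R -> R -> R) : Prop :=
  (forall t, null_p_frame (gamma^~ t) (g^~ t) (k1^~ t) (k2^~ t)) /\
  forall x t,
    derivable (g x) t 1 /\
    invmx (g x t) *m partial_t g x t =
    4^-1 *: mx3
      [:: [:: 0; - partial_x k2 x t; partial_x k1 x t];
          [:: - 2 * partial_x k1 x t; k1 x t * k2 x t; 0];
          [:: 2 * partial_x k2 x t; 0; - (k1 x t * k2 x t)]].

Definition second_flow (R : realType) (q r : R -> R -> R) : Prop :=
  forall x t,
    partial_t q x t =
      - 2^-1 * (partial_x (partial_x q) x t - 2 * q x t ^+ 2 * r x t) /\
    partial_t r x t =
      2^-1 * (partial_x (partial_x r) x t - 2 * q x t * r x t ^+ 2).

(* Main.v *)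
Require Import Defs.
From mathcomp Require Import all_boot all_order all_algebra.
From mathcomp Require Import all_classical all_reals all_analysis.
From mathcomp Require Import ring lra.
Import Order.TTheory GRing.Theory Num.Theory numFieldNormedType.Exports.

(** Null vectors orthogonal to the unit tangent e_0 can be written down
    rationally in the coordinates of e_0, which gives a global smooth frame N
    with values in SO(3, D_3) and e_0 = gamma_x.  Frames with the same e_0
    differ by a boost diag(1, c, c^-1), so the star operator is
    N diag(0, 1, -1) N^-1 and the flow expresses gamma_t, hence also the first
    column of N^-1 N_t, through N^-1 N_x.  A boost by c = e^f turns N into the
    required frame when f_x and f_t have prescribed values, and the zero
    curvature equation of N says exactly that these values form a closed
    1-form; f is then obtained from the Poincare lemma.  The zero curvature
    equation of the new frame is the second flow.  For uniqueness, the
    derivatives of g^-1 g' force the boost relating two solutions to be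
    constant. *)

Set Implicit Arguments.
Unset Strict Implicit.
Unset Printing Implicit Defensive.
Local Open Scope ring_scope.

(** * Functions of one variable *)

Lemma is_derive_continuous (R : realType) (V : normedModType R) (f df : R -> V) :
  (forall x : R, is_derive x 1 f (df x)) -> continuous f.
Proof.
move=> fdf x; apply/differentiable_continuous/derivable1_diffP.
by have [] := fdf x.
Qed.

(** No order between a and b is assumed, so that increments of either sign are covered; c is located
    by its distance to a only. *)
Lemma mean_value (R : realType) (f df : R -> R) (a b : R) :
  (forall x : R, is_derive x 1 f (df x)) ->
  exists2 c, `|c - a| <= `|b - a| & f b - f a = df c * (b - a).
Proof.
move=> fdf; have fc := is_derive_continuous fdf.
have [ab|/ltW ba] := leP a b.
- have [|c] := MVT_segment ab (fun x _ => fdf x).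
    exact: continuous_subspaceT.
  rewrite in_itv/= => /andP[ac cb] ->; exists c => //.
  by rewrite !ger0_norm ?subr_ge0//; lra.
- have [|c] := MVT_segment ba (fun x _ => fdf x).
    exact: continuous_subspaceT.
  rewrite in_itv/= => /andP[bc ca] e; exists c; last by lra.
  by rewrite !ler0_norm ?subr_le0//; lra.
Qed.

Lemma is_derive0_const (R : realType) (f : R -> R) :
  (forall x : R, is_derive x 1 f 0) -> forall x y, f x = f y.
Proof.
move=> f0 x y; have [c _] := mean_value y x f0.
by rewrite mul0r => /eqP; rewrite subr_eq0 => /eqP.
Qed.

Lemma local_primitive (R : realType) (a : R -> R) (b : R) : continuous a ->
  exists A : R -> R, forall x : R, b < x -> is_derive x 1 A (a x).
Proof.
move=> ca.
exists (fun x => \int[@lebesgue_measure R]_(t in [set` `[b, x]]) a t)%R => x bx.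
have xx : x < x + 1 by lra.
have [||dA <-] := @continuous_FTC1_closed R a b x (x + 1) xx _ bx.
- apply: continuous_compact_integrable; first exact: segment_compact.
  exact: continuous_subspaceT.
- exact: ca.
by rewrite derive1E; exact: DeriveDef.
Qed.

(** The primitives on the half-lines x > -n that contain 0, normalized to vanish at 0, agree
    wherever two of them are defined, and glue to a primitive on the whole line. *)
Lemma primitive (R : realType) (a : R -> R) : continuous a ->
  exists A : R -> R, forall x : R, is_derive x 1 A (a x).
Proof.
move=> ca.
have /choice[A Aa] (n : nat) := local_primitive (- n%:R) ca.
have Aconst (n m : nat) x : - n%:R < x -> - m%:R < x -> - n%:R < 0 :> R ->
    - m%:R < 0 :> R -> A n x - A n 0 = A m x - A m 0.
  move=> nx mx n0 m0.
  pose l := Num.min 0 x; pose u := Num.max 0 x.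
  have lu : l <= u by rewrite /l /u ge_min le_max lexx.
  have nl : - n%:R < l by rewrite lt_min n0.
  have ml : - m%:R < l by rewrite lt_min m0.
  have dB y : l <= y -> is_derive y 1 (A n - A m) 0.
    move=> ly; rewrite -(subrr (a y)); apply: is_deriveB; apply: Aa.
      exact: lt_le_trans ly.
    exact: lt_le_trans ly.
  have [||c _] := @MVT_segment R (A n - A m) (fun=> 0) l u lu.
  - by move=> y; rewrite in_itv/= => /andP[/ltW ly _]; exact: dB.
  - apply: derivable_within_continuous => y; rewrite in_itv/= => /andP[ly _].
    by have [] := dB _ ly.
  rewrite mul0r /l /u; have [_|_] := leP 0 x; rewrite !fctE/=; lra.
(* Two more than the truncation of |x|: x then lies more than 1 above the left end -N(x), so the
   index of x also serves all y near x. *)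
pose N (x : R) := (Num.truncn `|x|).+2.
have Nx x : - (N x)%:R + 1 < x.
  have := truncnS_gt `|x|; have := ler_norm (- x).
  have <- : (Num.truncn `|x|).+1%:R + 1 = (N x)%:R :> R by rewrite natr1.
  by rewrite normrN; lra.
have N0 x : - (N x)%:R < 0 :> R by rewrite oppr_lt0 ltr0n.
exists (fun x => A (N x) x - A (N x) 0) => x.
have dAx : is_derive x 1 (A (N x) - cst (A (N x) 0)) (a x).
  rewrite -(subr0 (a x)); apply: is_deriveB; apply: Aa.
  by have := Nx x; lra.
apply: near_eq_is_derive dAx.
near=> y; rewrite !fctE/=; apply: Aconst => //; last by have := Nx y; lra.
have := Nx x.
suff : x - 1 < y by lra.
by near: y; apply: lt_nbhsr; lra.
Unshelve. all: by end_near. Qed.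

(** * Smooth functions of two variables *)

Definition has_partials (R : realType) (V : normedModType R)
    (f fx ft : R -> R -> V) : Prop :=
  forall x t : R, is_derive x 1 (f^~ t) (fx x t) /\ is_derive t 1 (f x) (ft x t).

Definition continuous2 (R : realType) (V : normedModType R)
    (f : R -> R -> V) : Prop := continuous (fun p : R * R => f p.1 p.2).

Lemma has_partialsE (R : realType) (V : normedModType R)
    (f fx ft : R -> R -> V) :
  has_partials f fx ft -> partial_x f = fx /\ partial_t f = ft.
Proof.
move=> fP; split; apply/funext => x; apply/funext => t.
  by rewrite /partial_x derive1E; have [[_ ->]] := fP x t.
by rewrite /partial_t derive1E; have [_ [_ ->]] := fP x t.
Qed.

Lemma smooth_partials (R : realType) (V : normedModType R) (f : R -> R -> V) :
  smooth f -> has_partials f (partial_x f) (partial_t f).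
Proof.
move=> /(_ 1%N)[fx ft _ _] x t; split; apply: DeriveDef => //.
  by rewrite -derive1E.
by rewrite -derive1E.
Qed.

Lemma smooth_partial_x (R : realType) (V : normedModType R)
  (f : R -> R -> V) : smooth f -> smooth (partial_x f).
Proof. by move=> sf n; have [] := sf n.+1. Qed.

Lemma smooth_partial_t (R : realType) (V : normedModType R)
  (f : R -> R -> V) : smooth f -> smooth (partial_t f).
Proof. by move=> sf n; have [] := sf n.+1. Qed.

(** Coinduction principle: [smooth] is the largest class of continuous functions stable under both
    partial derivatives. *)
Lemma smooth_coind (R : realType) (V : normedModType R)
    (P : (R -> R -> V) -> Prop) :
  (forall f, P f -> continuous2 f /\
     exists fx ft, [/\ has_partials f fx ft, P fx & P ft]) ->
  forall f, P f -> smooth f.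
Proof.
move=> HP f Pf n; elim: n f Pf => [|n IH] f /HP[//= fc [fx [ft [fP Px Pt]]]].
have [-> ->] := has_partialsE fP.
by split; [move=> x t; have [[]] := fP x t|move=> x t; have [_ []] := fP x t
  |exact: IH|exact: IH].
Qed.

(** * Symmetry of mixed partial derivatives *)

(** The mean value theorem is applied first in x to f(., t + h) - f(., t), then in t to [fx y]. *)
Lemma second_difference (R : realType) (f fx fxt : R -> R -> R) :
  (forall x t : R, is_derive x 1 (f^~ t) (fx x t)) ->
  (forall x t : R, is_derive t 1 (fx x) (fxt x t)) ->
  forall x t h, exists y s, [/\ `|y - x| <= `|h|, `|s - t| <= `|h| &
    f (x + h) (t + h) - f (x + h) t - f x (t + h) + f x t = fxt y s * h * h].
Proof.
move=> df dfx x t h.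
have dD (y : R) : is_derive y 1 (f^~ (t + h) - f^~ t) (fx y (t + h) - fx y t).
  exact: is_deriveB.
have [y yx] := mean_value x (x + h) dD.
have [s st] := mean_value t (t + h) (dfx y).
have hE z : z + h - z = h by rewrite addrC addKr.
rewrite !hE !fctE in yx st * => e1 e2; exists y, s; split => //.
by rewrite -e1 -e2; ring.
Qed.

Lemma continuous2_near (R : realType) (f : R -> R -> R) :
  continuous2 f -> forall x t (e : R), 0 < e -> exists2 d, 0 < d &
    forall y s, `|y - x| < d -> `|s - t| < d -> `|f y s - f x t| < e.
Proof.
move=> fc x t e e0.
have /cvgrPdist_lt/(_ _ e0)/nbhs_ballP[d /= d0 H] := fc (x, t).
exists d => // y s yx st; rewrite distrC; apply: (H (y, s)).
by split; rewrite /ball/= distrC.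
Qed.

(** The second difference with step h is symmetric in the two variables, so it equals h^2 times
    either mixed partial, each at some point within h of (x, t) in both coordinates. Different
    values at (x, t) contradict continuity once h is small. *)
Lemma smooth_schwarz (R : realType) (f : R -> R -> R) : smooth f ->
  partial_t (partial_x f) = partial_x (partial_t f).
Proof.
move=> sf; apply/funext => x; apply/funext => t.
set u := (LHS); set v := RHS; apply/eqP; apply: contraT => uv.
have e0 : 0 < `|u - v| / 2 by rewrite divr_gt0// normr_gt0 subr_eq0.
have fP := smooth_partials sf.
have fxP := smooth_partials (smooth_partial_x sf).
have ftP := smooth_partials (smooth_partial_t sf).
have [d1 d10 H1] := continuous2_near
  (smooth_partial_t (smooth_partial_x sf) 0%N) x t e0.
have [d2 d20 H2] := continuous2_near
  (smooth_partial_x (smooth_partial_t sf) 0%N) x t e0.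
pose h := Num.min d1 d2 / 2.
have h0 : 0 < Num.min d1 d2 by rewrite lt_min d10.
have hlt d : Num.min d1 d2 <= d -> `|h| < d.
  by rewrite gtr0_norm ?divr_gt0// /h => ?; lra.
have h1 : `|h| < d1 by rewrite hlt// ge_min lexx.
have h2 : `|h| < d2 by rewrite hlt// ge_min lexx orbT.
have [||y [s [yx st e1]]] := @second_difference R f (partial_x f)
  (partial_t (partial_x f)) _ _ x t h.
- by move=> ? ?; apply: (fP _ _).1.
- by move=> ? ?; apply: (fxP _ _).2.
(* The same expansion with the roles of x and t exchanged. *)
have [||s' [y' [st' yx' e2]]] := @second_difference R (fun t x => f x t)
  (fun t x => partial_t f x t) (fun t x => partial_x (partial_t f) x t) _ _ t x h.
- by move=> ? ?; apply: (fP _ _).2.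
- by move=> ? ?; apply: (ftP _ _).1.
have hn0 : h != 0 by rewrite gt_eqF// divr_gt0.
have E : partial_t (partial_x f) y s = partial_x (partial_t f) y' s'.
  apply: (mulIf hn0); apply: (mulIf hn0); rewrite -e1 -e2; ring.
have := H1 y s (le_lt_trans yx h1) (le_lt_trans st h1).
have := H2 y' s' (le_lt_trans yx' h2) (le_lt_trans st' h2).
rewrite -/u -/v E; move: u v uv e0 H1 H2 => u v _ _ _ _.
move: (partial_x _ _ _) => p.
have := ler_normB (p - v) (p - u).
have -> : p - v - (p - u) = u - v by ring.
clear => ? ? ?; exfalso; lra.
Qed.

(** * Differentiation under the integral sign and the Poincare lemma *)

(** Uniformity in y comes from compactness of [-r, r], in the covering form that merges the local
    neighbourhoods of (y, t) into one neighbourhood of t. *)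
Lemma continuous2_unif (R : realType) (c : R -> R -> R) : continuous2 c ->
  forall r t e : R, 0 < e -> \forall s \near t,
    forall y, `|y| <= r -> `|c y s - c y t| < e.
Proof.
move=> cc r t e e0.
have /compact_near_coveringP := @segment_compact R (- r) r.
move=> /(_ R (nbhs t) (fun s y => `|c y s - c y t| < e)) H.
have {H} : \forall s \near t,
    (`[- r, r] `<=` (fun y => `|c y s - c y t| < e))%classic.
  apply: H => x _.
  have e20 : 0 < e / 2 by rewrite divr_gt0.
  have [d d0 Hd] := continuous2_near cc x t e20.
  exists (ball x d, ball t d); first by split; exact: nbhsx_ballx.
  move=> [y s]/= [yx st]; rewrite /ball/= distrC in yx st.
  rewrite (splitr e) -(subrKA (c x t)) (le_lt_trans (ler_normD _ _))// ltrD//.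
    by apply: Hd; rewrite // distrC.
  by rewrite distrC Hd// ?subrr ?normr0// distrC.
by apply: filterS => s Hs y; rewrite ler_norml => yr; apply: Hs; rewrite /= in_itv.
Qed.

(** Differentiation under the integral sign, phrased with primitives: F x t - F 0 t stands for the
    integral of a(., t) from 0 to x, and b x t - b 0 t for the integral of its t-derivative. *)
Lemma is_derive_under_primitive (R : realType) (F a at_ b : R -> R -> R) :
  (forall x t : R, is_derive x 1 (F^~ t) (a x t)) ->
  (forall x t : R, is_derive t 1 (a x) (at_ x t)) ->
  (forall x t : R, is_derive x 1 (b^~ t) (at_ x t)) ->
  continuous2 at_ ->
  forall x t : R, is_derive t 1 (fun s => F x s - F 0 s) (b x t - b 0 t).
Proof.
move=> dF da db cc x t.
suff H : ((fun h => h^-1 *: ((F x (h + t) - F 0 (h + t)) - (F x t - F 0 t)))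
    @ 0^' --> (b x t - b 0 t : R))%classic.
  apply: DeriveDef; first by apply/cvg_ex; exists (b x t - b 0 t);
    under eq_fun do rewrite scaler1.
  by apply: cvg_lim => //; under eq_fun do rewrite scaler1.
apply/cvgrPdist_le => e e0.
(* [|x|] bounds the length of the interval but may vanish, hence the division by [|x| + 1]. *)
have r0 : 0 < `|x| + 1 by rewrite ltr_wpDl.
have e1 : 0 < e / (`|x| + 1) by rewrite divr_gt0.
have /nbhs_ballP[d /= d0 Hd] := continuous2_unif cc `|x| t e1.
near=> h.
have hd : `|h| < d by near: h; exact: dnbhs0_lt.
have h0 : h != 0 by near: h; exact: nbhs_dnbhs_neq.
(* This is the error of the linear approximation in h. By the mean value theorem in t its derivative
   at y is h (at_ y s - at_ y t) for some s within h of t, which is small compared to h uniformly in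
   y. *)
have dD (y : R) : is_derive y 1 (F^~ (h + t) - F^~ t - h \*: b^~ t)
    (a y (h + t) - a y t - h *: at_ y t).
  exact: is_deriveB.
have [y yx] := mean_value 0 x dD.
have [s st] := mean_value t (h + t) (da y).
rewrite addrK in st *; rewrite !subr0 in yx *; rewrite !fctE/= => es ey.
have -> : b x t - b 0 t
    - h^-1 *: (F x (h + t) - F 0 (h + t) - (F x t - F 0 t))
    = - ((at_ y s - at_ y t) * x).
  apply: (mulfI h0); rewrite mulrBr; rewrite [h * (h^-1 *: _)]mulVKf//.
  rewrite /GRing.scale/= in ey es *.
  have -> : h * - ((at_ y s - at_ y t) * x) =
     - ((at_ y s * h - h * at_ y t) * x) by ring.
  by rewrite -es -ey; ring.
rewrite normrN normrM; have : `|at_ y s - at_ y t| <= e / (`|x| + 1).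
  apply/ltW/Hd => //=; first by rewrite /ball/= distrC (le_lt_trans st).
move=> H; apply: le_trans (_ : e / (`|x| + 1) * (`|x| + 1) <= _);
  last by rewrite divfK// gt_eqF.
by apply: ler_pM => //; rewrite lerDl.
Unshelve. all: by end_near. Qed.

(** The increment from (x0, t0) to (x, t) is split at (x0, t): in x the mean value theorem applies
    with [a] bounded by M near (x0, t0), and in t the function f(x0, .) is differentiable, hence
    continuous. *)
Lemma has_partials_continuous (R : realType) (f a b : R -> R -> R) :
  has_partials f a b -> continuous2 a -> continuous2 f.
Proof.
move=> fP ac [x0 t0]; apply/cvgrPdist_lt => e e0 /=.
have [d d0 Hd] := continuous2_near ac x0 t0 ltr01.
have ct : continuous (f x0).
  by apply: (@is_derive_continuous _ _ _ (b x0)) => t; have [] := fP x0 t.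
pose M := `|a x0 t0| + 1.
have M0 : 0 < M by rewrite ltr_wpDl.
have e20 : 0 < e / 2 by rewrite divr_gt0.
have n1 (r : R) : 0 < r -> \forall p \near (x0, t0), `|p.1 - x0| < r.
  move=> r0; exists (ball x0 r, setT).
    by split; [exact: nbhsx_ballx|exact: filterT].
  by move=> [y s]/= [+ _]; rewrite /ball/= distrC.
have n2 (r : R) : 0 < r -> \forall p \near (x0, t0), `|p.2 - t0| < r.
  move=> r0; exists (setT, ball t0 r).
    by split; [exact: filterT|exact: nbhsx_ballx].
  by move=> [y s]/= [_]; rewrite /ball/= distrC.
have n3 : \forall p \near (x0, t0), `|f x0 t0 - f x0 p.2| < e / 2.
  exists (setT, [set s | `|f x0 t0 - f x0 s| < e / 2])%classic;
    last by move=> [y s]/= [_].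
  by split; [exact: filterT|have /cvgrPdist_lt := ct t0; exact].
near=> p.
have px : `|p.1 - x0| < d by near: p; exact: n1.
have pt : `|p.2 - t0| < d by near: p; exact: n2.
have [y yx e1] := mean_value x0 p.1 (fun x => (fP x p.2).1).
rewrite (splitr e) -(subrKA (f x0 p.2)) (le_lt_trans (ler_normD _ _))// ltrD//.
  by near: p.
rewrite distrC e1 normrM.
have aM : `|a y p.2| <= M.
  have := Hd y p.2 (le_lt_trans yx px) pt; rewrite /M => /ltW.
  by have := ler_normD (a y p.2 - a x0 t0) (a x0 t0); rewrite subrK; lra.
apply: (@le_lt_trans _ _ (M * `|p.1 - x0|)); first by rewrite ler_wpM2r.
rewrite mulrC -ltr_pdivlMr//.
by near: p; apply: n1; rewrite divr_gt0.
Unshelve. all: by end_near. Qed.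

Lemma poincare (R : realType) (a b : R -> R -> R) : smooth a -> smooth b ->
  partial_t a = partial_x b -> exists2 f, smooth f & has_partials f a b.
Proof.
move=> sa sb ab; have aP := smooth_partials sa; have bP := smooth_partials sb.
have ax t : continuous (a^~ t) := is_derive_continuous (fun x => (aP x t).1).
have /choice[F dF] t := primitive (ax t).
have [G dG] := primitive (is_derive_continuous (fun t => (bP 0 t).2)).
(* Integral of a dx + b dt up the t-axis, then horizontally. Subtracting [F t 0] removes the
   constant chosen separately for each t; the horizontal part has t-derivative b x t - b 0 t because
   a_t = b_x. *)
pose f x t := F t x - F t 0 + G t.
have fP : has_partials f a b.
  move=> x t; split.
    rewrite -[a x t](subr0) -[a x t - 0]addr0.
    exact: (@is_deriveD _ _ _ (F t - cst (F t 0)) (cst (G t))).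
  rewrite -[b x t](subrK (b 0 t)).
  apply: (@is_deriveD _ _ _ (fun s => F s x - F s 0) G).
  apply: (@is_derive_under_primitive R (fun x t => F t x) a (partial_t a)) => //.
  - by move=> y s; apply: (aP _ _).2.
  - by move=> y s; rewrite ab; apply: (bP _ _).1.
  - exact: (smooth_partial_t sa 0%N).
exists f => // -[|n]; first exact: has_partials_continuous fP (sa 0%N).
rewrite /=; have [-> ->] := has_partialsE fP.
by split=> [x t|x t||]; [have [[]] := fP x t|have [_ []] := fP x t|apply: sa|apply: sb].
Qed.

(* Derivatives of the functions in this class stay in it, which by
   [smooth_coind] gives all closure properties of [smooth] at once. *)
Inductive smooth_gen (R : realType) : (R -> R -> R) -> Prop :=
| smooth_gen_base f : smooth f -> smooth_gen f
| smooth_gen_cst c : smooth_gen (fun _ _ => c)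
| smooth_gen_add f g : smooth_gen f -> smooth_gen g ->
    smooth_gen (fun x t => f x t + g x t)
| smooth_gen_mul f g : smooth_gen f -> smooth_gen g ->
    smooth_gen (fun x t => f x t * g x t)
| smooth_gen_inv f : smooth_gen f -> (forall x t, f x t != 0) ->
    smooth_gen (fun x t => (f x t)^-1)
| smooth_gen_exp f : smooth_gen f -> smooth_gen (fun x t => expR (f x t)).

Lemma smooth_gen_smooth (R : realType) (f : R -> R -> R) :
  smooth_gen f -> smooth f.
Proof.
move: f; apply: smooth_coind => f; elim=> {f}.
- move=> f sf; split; first exact: (sf 0%N).
  exists (partial_x f), (partial_t f); split; first exact: smooth_partials.
    exact/smooth_gen_base/smooth_partial_x.
  exact/smooth_gen_base/smooth_partial_t.
- move=> c; split; first exact: cst_continuous.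
  exists (fun _ _ => 0), (fun _ _ => 0); split; try exact: smooth_gen_cst.
  by move=> x t; split; exact: is_derive_cst.
- move=> f g gf [fc [fx [ft [fP gfx gft]]]] gg [gc [gx [gt [gP ggx ggt]]]].
  split; first by move=> p; apply: cvgD; [exact: fc|exact: gc].
  exists (fun x t => fx x t + gx x t), (fun x t => ft x t + gt x t).
  split; try exact: smooth_gen_add.
  by move=> x t; have [? ?] := fP x t; have [? ?] := gP x t; split;
    apply: is_deriveD.
- move=> f g gf [fc [fx [ft [fP gfx gft]]]] gg [gc [gx [gt [gP ggx ggt]]]].
  split; first by move=> p; apply: cvgM; [exact: fc|exact: gc].
  exists (fun x t => f x t * gx x t + g x t * fx x t),
    (fun x t => f x t * gt x t + g x t * ft x t).
  split; try by apply: smooth_gen_add; apply: smooth_gen_mul.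
  by move=> x t; have [? ?] := fP x t; have [? ?] := gP x t; split;
    apply: is_deriveM.
- move=> f gf [fc [fx [ft [fP gfx gft]]]] f0.
  split; first by move=> p; apply: cvgV; [exact: f0|exact: fc].
  have gi := smooth_gen_inv gf f0.
  (* The derivative of 1/f is written with constants, products and inverses, the shapes that the
     constructors of [smooth_gen] accept. *)
  exists (fun x t => -1 * ((f x t)^-1 * (f x t)^-1) * fx x t),
    (fun x t => -1 * ((f x t)^-1 * (f x t)^-1) * ft x t).
  split; try by do ![apply: smooth_gen_mul => //]; exact: smooth_gen_cst.
  move=> x t; have [dx dt] := fP x t; rewrite mulN1r -expr2 exprVn.
  by split; [exact: (is_deriveV (f0 x t) dx)|exact: (is_deriveV (f0 x t) dt)].
- move=> f gf [fc [fx [ft [fP gfx gft]]]].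
  split; first by move=> p; apply: continuous_comp;
    [exact: fc|exact: continuous_expR].
  have ge := smooth_gen_exp gf.
  exists (fun x t => expR (f x t) * fx x t), (fun x t => expR (f x t) * ft x t).
  split; try exact: smooth_gen_mul.
  by move=> x t; have [dx dt] := fP x t; split;
   [apply: (@is_derive1_comp R expR (f^~ t))|apply: (@is_derive1_comp R expR (f x))].
Qed.

(** * Matrix-valued functions *)

Lemma is_derive_unique (R : realType) (V : normedModType R) (f : R -> V)
    (x : R) (a b : V) :
  is_derive x 1 f a -> is_derive x 1 f b -> a = b.
Proof. by move=> [_ <-] [_ <-]. Qed.

Lemma is_derive_mxP (R : realType) m n (F : R -> 'M[R]_(m, n)) (x : R)
    (dF : 'M[R]_(m, n)) :
  is_derive x 1 F dF <-> forall i j, is_derive x 1 (fun y => F y i j) (dF i j).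
Proof.
split=> [[dx <-] i j|H].
  have /derivable_mxP/(_ i j) dij := dx.
  by apply: DeriveDef => //; rewrite derive_mx// mxE.
have dx : derivable F x 1 by apply/derivable_mxP => i j; have [] := H i j.
apply: DeriveDef => //; rewrite derive_mx//; apply/matrixP => i j.
by rewrite mxE; have [_ ->] := H i j.
Qed.

Lemma is_derive_mulmx (R : realType) m n p (F : R -> 'M[R]_(m, n))
    (G : R -> 'M[R]_(n, p)) (x : R) dF dG :
  is_derive x 1 F dF -> is_derive x 1 G dG ->
  is_derive x 1 (fun y => F y *m G y) (dF *m G x + F x *m dG).
Proof.
move=> /is_derive_mxP HF /is_derive_mxP HG; apply/is_derive_mxP => i j.
rewrite !mxE -big_split/=.
have -> : (fun y => (F y *m G y) i j) =
    \sum_(k < n) ((fun y => F y i k) * (fun y => G y k j)).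
  by apply/funext => y; rewrite mxE fct_sumE.
apply: is_derive_sum => k.
apply: is_derive_eq; rewrite addrC /GRing.scale/=; congr (_ + _).
exact: mulrC.
Qed.

Lemma is_derive_trmx (R : realType) m n (F : R -> 'M[R]_(m, n)) (x : R) dF :
  is_derive x 1 F dF -> is_derive x 1 (fun y => (F y)^T) dF^T.
Proof.
move=> /is_derive_mxP HF; apply/is_derive_mxP => i j; rewrite mxE.
by under eq_fun do rewrite mxE.
Qed.

Lemma is_derive_mulmxl (R : realType) m n p (A : 'M[R]_(m, n))
    (G : R -> 'M[R]_(n, p)) (x : R) dG :
  is_derive x 1 G dG -> is_derive x 1 (fun y => A *m G y) (A *m dG).
Proof.
move=> HG; have := is_derive_mulmx (is_derive_cst A x 1) HG.
by rewrite mul0mx add0r.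
Qed.

Lemma has_partials_mxP (R : realType) m n (F Fx Ft : R -> R -> 'M[R]_(m, n)) :
  has_partials F Fx Ft <-> forall i j, has_partials (fun x t => F x t i j)
    (fun x t => Fx x t i j) (fun x t => Ft x t i j).
Proof.
split=> [H i j x t|H x t].
  by have [/is_derive_mxP Hx /is_derive_mxP Ht] := H x t.
by split; apply/is_derive_mxP => i j; have [] := H i j x t.
Qed.

Lemma continuous2_mxP (R : realType) m n (F : R -> R -> 'M[R]_(m, n)) :
  continuous2 F <-> forall i j, continuous2 (fun x t => F x t i j).
Proof.
split=> [Fc i j p|Fc p].
  exact: (continuous_comp (Fc p) (@coord_continuous _ _ _ i j _)).
apply/cvgrPdist_le => e e0; near=> q.
rewrite /Num.Def.normr/= mx_normrE (bigmax_le _ (ltW e0))//= => i _.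
rewrite !mxE/=.
move: i; near: q; apply: filter_forall => /= i.
exact: ((cvgrPdist_le _ _).1 (Fc i.1 i.2 p)).
Unshelve. all: by end_near. Qed.

(** Both directions are coinductive: the entries of smooth matrix functions form a class stable
    under partial derivatives, and so do the matrix functions with smooth entries. *)
Lemma smooth_mxP (R : realType) m n (F : R -> R -> 'M[R]_(m, n)) :
  smooth F <-> forall i j, smooth (fun x t => F x t i j).
Proof.
split=> [sF i j|].
  apply: (@smooth_coind _ _ (fun f => exists2 G : R -> R -> 'M[R]_(m, n),
    smooth G & f = fun x t => G x t i j)); last by exists F.
  move=> _ [G sG ->]; split.
    by have /continuous2_mxP := sG 0%N; exact.
  exists (fun x t => partial_x G x t i j), (fun x t => partial_t G x t i j).
  split; first by have /has_partials_mxP := smooth_partials sG; exact.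
    by exists (partial_x G) => //; exact: smooth_partial_x.
  by exists (partial_t G) => //; exact: smooth_partial_t.
move: F; apply: smooth_coind => F sF; split.
  by apply/continuous2_mxP => i j; exact: (sF i j 0%N).
exists (fun x t => \matrix_(i, j) partial_x (fun x t => F x t i j) x t).
exists (fun x t => \matrix_(i, j) partial_t (fun x t => F x t i j) x t).
split.
- apply/has_partials_mxP => i j x t; rewrite !mxE.
  exact: (smooth_partials (sF i j)).
- move=> i j; under [X in smooth X]eq_fun do under eq_fun do rewrite mxE.
  exact/smooth_partial_x.
- move=> i j; under [X in smooth X]eq_fun do under eq_fun do rewrite mxE.
  exact/smooth_partial_t.
Qed.

Lemma smooth_sum (R : realType) n (f : 'I_n -> R -> R -> R) :
  (forall k, smooth (f k)) -> smooth (fun x t => \sum_k f k x t).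
Proof.
move=> sf; apply: smooth_gen_smooth.
elim: n f sf => [|n IH] f sf.
  under [X in smooth_gen X]eq_fun do under eq_fun do rewrite big_ord0.
  exact: smooth_gen_cst.
under [X in smooth_gen X]eq_fun do under eq_fun do rewrite big_ord_recl.
by apply: smooth_gen_add; [exact/smooth_gen_base|exact: IH].
Qed.

Lemma smooth_mulmx (R : realType) m n p (F : R -> R -> 'M[R]_(m, n))
    (G : R -> R -> 'M[R]_(n, p)) :
  smooth F -> smooth G -> smooth (fun x t => F x t *m G x t).
Proof.
move=> /smooth_mxP sF /smooth_mxP sG; apply/smooth_mxP => i j.
under [X in smooth X]eq_fun do under eq_fun do rewrite mxE.
by apply: smooth_sum => k; apply: smooth_gen_smooth;
  apply: smooth_gen_mul; exact: smooth_gen_base.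
Qed.

Lemma smooth_cst (R : realType) m n (A : 'M[R]_(m, n)) :
  smooth (fun _ _ : R => A).
Proof.
by apply/smooth_mxP => i j; apply: smooth_gen_smooth; exact: smooth_gen_cst.
Qed.

Lemma smooth_trmx (R : realType) m n (F : R -> R -> 'M[R]_(m, n)) :
  smooth F -> smooth (fun x t => (F x t)^T).
Proof.
move=> /smooth_mxP sF; apply/smooth_mxP => i j.
under [X in smooth X]eq_fun do under eq_fun do rewrite mxE.
exact: sF.
Qed.

Lemma smooth_schwarz_mx (R : realType) m n (F : R -> R -> 'M[R]_(m, n)) :
  smooth F -> partial_t (partial_x F) = partial_x (partial_t F).
Proof.
move=> sF; have /smooth_mxP sFij := sF.
have E (G : R -> R -> 'M[R]_(m, n)) i j : smooth G ->
    partial_x (fun x t => G x t i j) = (fun x t => partial_x G x t i j) /\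
    partial_t (fun x t => G x t i j) = (fun x t => partial_t G x t i j).
  move=> sG; have /has_partials_mxP/(_ i j) := smooth_partials sG.
  exact: has_partialsE.
apply/funext => x; apply/funext => t; apply/matrixP => i j.
have [_ Etx] := E _ i j (smooth_partial_x sF).
have [Ext _] := E _ i j (smooth_partial_t sF).
transitivity (partial_t (fun x t => partial_x F x t i j) x t).
  by rewrite Etx.
transitivity (partial_x (fun x t => partial_t F x t i j) x t).
  by have [<- <-] := E F i j sF; rewrite smooth_schwarz.
by rewrite Ext.
Qed.

(** * Matrices of size three *)

Local Notation M3 a b c d e f g h i :=
  (mx3 [:: [:: a; b; c]; [:: d; e; f]; [:: g; h; i]]).

Lemma ord3P (P : 'I_3 -> Prop) : P 0 -> P 1 -> P 2 -> forall i, P i.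
Proof.
move=> P0 P1 P2 [[|[|[|//]]] Hi].
- by rewrite (_ : Ordinal Hi = 0)//; exact: val_inj.
- by rewrite (_ : Ordinal Hi = 1)//; exact: val_inj.
- by rewrite (_ : Ordinal Hi = 2)//; exact: val_inj.
Qed.

(** A tuple of equations serves as a multirule: [rewrite mx3E] selects the entry that occurs. *)
Lemma mx3E (R : realType) (a b c d e f g h i : R) :
  let M := M3 a b c d e f g h i in
  ((M 0 0 = a) * (M 0 1 = b) * (M 0 2 = c) * (M 1 0 = d) * (M 1 1 = e) *
  (M 1 2 = f) * (M 2 0 = g) * (M 2 1 = h) * (M 2 2 = i))%type.
Proof. by rewrite /= !mxE. Qed.

Lemma mx3_eta (R : realType) (A : 'M[R]_3) :
  A = M3 (A 0 0) (A 0 1) (A 0 2) (A 1 0) (A 1 1) (A 1 2) (A 2 0) (A 2 1) (A 2 2).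
Proof.
by apply/matrixP; elim/ord3P; elim/ord3P; rewrite mx3E.
Qed.

Lemma mulmx_3E (R : realType) n p (A : 'M[R]_(n, 3)) (B : 'M[R]_(3, p)) i j :
  (A *m B) i j = A i 0 * B 0 j + A i 1 * B 1 j + A i 2 * B 2 j.
Proof.
rewrite mxE !big_ord_recl big_ord0 addr0 !addrA.
by congr (_ * B _ j + A _ _ * B _ j + A _ _ * B _ j); try exact: val_inj;
  congr (A _ _); exact: val_inj.
Qed.

Lemma mulmx3 (R : realType) (a b c d e f g h i a' b' c' d' e' f' g' h' i' : R) :
  M3 a b c d e f g h i *m M3 a' b' c' d' e' f' g' h' i' =
  M3 (a * a' + b * d' + c * g') (a * b' + b * e' + c * h')
     (a * c' + b * f' + c * i')
     (d * a' + e * d' + f * g') (d * b' + e * e' + f * h')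
     (d * c' + e * f' + f * i')
     (g * a' + h * d' + i * g') (g * b' + h * e' + i * h')
     (g * c' + h * f' + i * i').
Proof.
by apply/matrixP; elim/ord3P; elim/ord3P; rewrite mulmx_3E !mx3E.
Qed.

Lemma addmx3 (R : realType) (a b c d e f g h i a' b' c' d' e' f' g' h' i' : R) :
  M3 a b c d e f g h i + M3 a' b' c' d' e' f' g' h' i' =
  M3 (a + a') (b + b') (c + c') (d + d') (e + e') (f + f')
     (g + g') (h + h') (i + i').
Proof. by apply/matrixP; elim/ord3P; elim/ord3P; rewrite mxE !mx3E. Qed.

Lemma scalemx3 (R : realType) (k a b c d e f g h i : R) :
  k *: M3 a b c d e f g h i =
  M3 (k * a) (k * b) (k * c) (k * d) (k * e) (k * f) (k * g) (k * h) (k * i).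
Proof. by apply/matrixP; elim/ord3P; elim/ord3P; rewrite mxE !mx3E. Qed.

Lemma trmx3 (R : realType) (a b c d e f g h i : R) :
  (M3 a b c d e f g h i)^T = M3 a d g b e h c f i.
Proof. by apply/matrixP; elim/ord3P; elim/ord3P; rewrite mxE !mx3E. Qed.

Lemma scalar_mx3 (R : realType) (k : R) : k%:M = M3 k 0 0 0 k 0 0 0 k.
Proof. by apply/matrixP; elim/ord3P; elim/ord3P; rewrite mxE !mx3E. Qed.

Lemma det_mx22 (R : comNzRingType) (A : 'M[R]_2) :
  \det A = A 0 0 * A 1 1 - A 0 1 * A 1 0.
Proof.
rewrite (expand_det_row _ 0) !big_ord_recl big_ord0 /cofactor !det_mx11 !mxE.
rewrite /= expr0 expr1 mul1r addr0 mulN1r mulrN.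
by congr (_ * A _ _ - A _ _ * A _ _); exact: val_inj.
Qed.

Lemma det_mx3 (R : realType) (a b c d e f g h i : R) :
  \det (M3 a b c d e f g h i) =
  a * (e * i - f * h) - b * (d * i - f * g) + c * (d * h - e * g).
Proof.
rewrite (expand_det_row _ 0) !big_ord_recl big_ord0 /cofactor.
rewrite !det_mx22 !mxE /= /bump/=; ring.
Qed.

Lemma mx3_inj (R : realType) (a b c d e f g h i a' b' c' d' e' f' g' h' i' : R) :
  M3 a b c d e f g h i = M3 a' b' c' d' e' f' g' h' i' ->
  [/\ [/\ a = a', b = b' & c = c'], [/\ d = d', e = e' & f = f']
    & [/\ g = g', h = h' & i = i']].
Proof.
move=> E; pose F i j := congr1 (fun M : 'M[R]_3 => M i j) E.
have := (F 0 0, F 0 1, F 0 2, F 1 0, F 1 1, F 1 2, F 2 0, F 2 1, F 2 2).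
by rewrite /F !mx3E => -[[[[[[[[]]]]]]]].
Qed.

(** * Lorentz frames *)

Definition lorentz (R : realType) (A : 'M[R]_3) : Prop :=
  A^T *m D3 R *m A = D3 R.

(** This is D_3^-1 A^T D_3, the numerical factor being D_3^-1. It is linear in A, so it can be
    differentiated, and shown to be smooth, without handling [invmx]. *)
Definition lorentz_inv (R : realType) (A : 'M[R]_3) : 'M[R]_3 :=
  M3 1 0 0 0 0 2 0 2 0 *m A^T *m D3 R.

(** The general element of the Lie algebra of O(3, D_3): l1 and l2 are the components along e_1 and
    e_2 of the derivative of e_0, and w is the connection form of the normal bundle. Null p-frames
    are the case w = 0. *)
Definition connection (R : realType) (l1 l2 w : R) : 'M[R]_3 :=
  M3 0 (- (l2 / 2)) (- (l1 / 2)) l1 w 0 l2 0 (- w).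

Definition boost (R : realType) (c : R) : 'M[R]_3 := M3 1 0 0 0 c 0 0 0 c^-1.

Lemma lorentz_invK (R : realType) (A : 'M[R]_3) :
  lorentz A -> lorentz_inv A *m A = 1%:M.
Proof.
move=> AO; rewrite /lorentz_inv -!mulmxA (mulmxA A^T) AO /D3 mulmx3 scalar_mx3.
by congr (M3 _ _ _ _ _ _ _ _ _); field.
Qed.

Lemma lorentz_invVK (R : realType) (A : 'M[R]_3) :
  lorentz A -> A *m lorentz_inv A = 1%:M.
Proof. by move=> /lorentz_invK/mulmx1C. Qed.

Lemma invmx_lorentz (R : realType) (A : 'M[R]_3) : lorentz A ->
  A \in unitmx /\ invmx A = lorentz_inv A.
Proof.
move=> /lorentz_invK AA; have [_ Au] := mulmx1_unit AA; split=> //.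
by rewrite -[RHS]mulmx1 -(mulmxV Au) mulmxA AA mul1mx.
Qed.

Lemma infinitesimal_lorentz (R : realType) (A : 'M[R]_3) :
  A^T *m D3 R + D3 R *m A = 0 -> A = connection (A 1 0) (A 2 0) (A 1 1).
Proof.
have Z : (0 : 'M[R]_3) = M3 0 0 0 0 0 0 0 0 0 by rewrite -scalar_mx3 raddf0.
rewrite (mx3_eta A) /D3 trmx3 !mulmx3 addmx3 Z /connection !mx3E.
move=> /mx3_inj [[? ? ?] [? ? ?] [? ? ?]].
by congr (M3 _ _ _ _ _ _ _ _ _); lra.
Qed.

(** On the Lie algebra, A^T D_3 + D_3 A = 0 reads D_3^-1 A^T D_3 = -A. *)
Lemma lorentz_inv_connection (R : realType) (l1 l2 w : R) :
  lorentz_inv (connection l1 l2 w) = - connection l1 l2 w.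
Proof.
rewrite /lorentz_inv -scaleN1r /connection /D3 trmx3 !mulmx3 scalemx3.
by congr (M3 _ _ _ _ _ _ _ _ _); field.
Qed.

(** Differentiating N^T D_3 N = D_3 shows that N^-1 N' lies in the Lie algebra. *)
Lemma lorentz_connection (R : realType) (N : R -> 'M[R]_3) (x : R) dN :
  (forall y, lorentz (N y)) -> is_derive x 1 N dN ->
  let A := lorentz_inv (N x) *m dN in
  dN = N x *m connection (A 1 0) (A 2 0) (A 1 1).
Proof.
move=> NO dNx A.
have NA : dN = N x *m A by rewrite mulmxA lorentz_invVK ?mul1mx.
rewrite [LHS]NA; congr (_ *m _); apply: infinitesimal_lorentz.
have d1 : is_derive x 1 (fun y => (N y)^T *m (D3 R *m N y))
    (dN^T *m (D3 R *m N x) + (N x)^T *m (D3 R *m dN)).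
  by apply: is_derive_mulmx; [exact: is_derive_trmx|exact: is_derive_mulmxl].
have d2 : is_derive x 1 (fun y => (N y)^T *m (D3 R *m N y)) 0.
  have -> : (fun y => (N y)^T *m (D3 R *m N y)) = cst (D3 R).
    by apply/funext => y; rewrite mulmxA NO.
  exact: is_derive_cst.
have := is_derive_unique d1 d2.
rewrite NA trmx_mul -!mulmxA (mulmxA (D3 R)) (mulmxA (N x)^T (_ *m _) A).
by rewrite (mulmxA (N x)^T (D3 R) (N x)) NO.
Qed.

(** P^-1 Q fixes the first basis vector and preserves the form, so it maps null normal directions to
    null normal directions; determinant 1 excludes their exchange. *)
Lemma lorentz_stabilizer (R : realType) (P Q : 'M[R]_3) :
  lorentz P -> lorentz Q -> \det P = 1 -> \det Q = 1 -> col 0 P = col 0 Q ->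
  let c := (lorentz_inv P *m Q) 1 1 in c != 0 /\ Q = P *m boost c.
Proof.
move=> PO QO dP dQ PQ; set M := lorentz_inv P *m Q => c.
have QE : Q = P *m M by rewrite mulmxA lorentz_invVK ?mul1mx.
have dM : \det M = 1 by have := dQ; rewrite QE det_mulmx dP mul1r.
have MO : lorentz M.
  have := QO; rewrite QE /lorentz trmx_mul -!mulmxA (mulmxA P^T) (mulmxA _ P).
  by rewrite PO mulmxA.
have M0 : col 0 M = col 0 1%:M.
  have := congr1 (mulmx (lorentz_inv P)) PQ.
  by rewrite !colE !mulmxA lorentz_invK.
have M0' i : M i 0 = (i == 0)%:R.
  by have /matrixP/(_ i 0) := M0; rewrite !mxE.
suff [c0 ME] : c != 0 /\ M = boost c by rewrite -ME -QE.
move: dM MO; rewrite /lorentz /c (mx3_eta M) !M0' /D3 trmx3 !mulmx3 det_mx3 mx3E.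
move: (M 0 1) (M 0 2) (M 1 1) (M 1 2) (M 2 1) (M 2 2) => m01 m02 m11 m12 m21 m22.
move=> dM /mx3_inj [] [_ e01 e02] [_ e11 e12] [_ _ e22].
rewrite /= in dM e01 e02 e11 e12 e22.
have {}e01 : m01 = 0 by lra.
have {}e02 : m02 = 0 by lra.
subst m01 m02.
(* The form gives m11 m22 + m12 m21 = 1 and the determinant gives m11 m22 - m12 m21 = 1. *)
have h1 : m11 * m22 = 1 by lra.
have c0 : m11 != 0 by apply: contra_eq_neq h1 => ->; rewrite mul0r eq_sym oner_neq0.
have d0 : m22 != 0 by apply: contra_eq_neq h1 => ->; rewrite mulr0 eq_sym oner_neq0.
have e21 : m21 = 0 by apply: (mulfI c0); lra.
have e12' : m12 = 0 by apply: (mulfI d0); lra.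
split=> //; rewrite e21 e12' /boost; congr (M3 _ _ _ _ _ _ _ _ _).
by apply: (mulfI c0); rewrite h1 mulfV.
Qed.

(** [lorentz_inv] is linear and reverses products, so for P' = P A the derivative of P^-1 is
    [lorentz_inv (P *m A)], that is -A P^-1. *)
Lemma is_derive_relative (R : realType) (P Q : R -> 'M[R]_3) (x l1 l2 w : R) K :
  (forall y, lorentz (P y)) ->
  is_derive x 1 P (P x *m connection l1 l2 w) ->
  is_derive x 1 Q (Q x *m K) ->
  let M y := lorentz_inv (P y) *m Q y in
  is_derive x 1 M (M x *m K - connection l1 l2 w *m M x).
Proof.
move=> PO dP dQ M.
have dA : is_derive x 1 (fun y => lorentz_inv (P y))
    (lorentz_inv (P x *m connection l1 l2 w)).
  rewrite /lorentz_inv; under [X in is_derive _ _ X]eq_fun do rewrite -mulmxA.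
  rewrite -mulmxA; apply: is_derive_mulmxl.
  have := is_derive_mulmx (is_derive_trmx dP) (is_derive_cst (D3 R) x 1).
  by rewrite mulmx0 addr0.
have := is_derive_mulmx dA dQ; rewrite /M.
suff -> : lorentz_inv (P x *m connection l1 l2 w) =
    - (connection l1 l2 w *m lorentz_inv (P x)).
  by rewrite addrC !mulmxA mulNmx.
rewrite -mulNmx -lorentz_inv_connection /lorentz_inv trmx_mul.
have DD : D3 R *m M3 1 0 0 0 0 2 0 2 0 = 1%:M.
  by rewrite mulmx3 scalar_mx3; congr (M3 _ _ _ _ _ _ _ _ _); field.
by rewrite -!mulmxA (mulmxA (D3 R)) DD mul1mx.
Qed.

Lemma is_derive_mx3 (R : realType) (a b c d e f g h i : R -> R) (x : R)
    (a' b' c' d' e' f' g' h' i' : R) :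
  is_derive x 1 a a' -> is_derive x 1 b b' -> is_derive x 1 c c' ->
  is_derive x 1 d d' -> is_derive x 1 e e' -> is_derive x 1 f f' ->
  is_derive x 1 g g' -> is_derive x 1 h h' -> is_derive x 1 i i' ->
  is_derive x 1
    (fun y => M3 (a y) (b y) (c y) (d y) (e y) (f y) (g y) (h y) (i y))
    (M3 a' b' c' d' e' f' g' h' i').
Proof.
move=> *; apply/is_derive_mxP; elim/ord3P; elim/ord3P;
  by under eq_fun do rewrite mx3E; rewrite mx3E.
Qed.

Lemma smooth_mx3 (R : realType) (a b c d e f g h i : R -> R -> R) :
  smooth a -> smooth b -> smooth c -> smooth d -> smooth e -> smooth f ->
  smooth g -> smooth h -> smooth i ->
  smooth (fun x t => M3 (a x t) (b x t) (c x t) (d x t) (e x t) (f x t)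
    (g x t) (h x t) (i x t)).
Proof.
move=> sa sb sc sd se sf sg sh si; apply/smooth_mxP.
elim/ord3P; elim/ord3P;
  by under [X in smooth X]eq_fun do under eq_fun do rewrite mx3E.
Qed.

Lemma lorentz_boost (R : realType) (N : 'M[R]_3) (c : R) : c != 0 ->
  lorentz N -> lorentz (N *m boost c).
Proof.
move=> c0 NO; rewrite /lorentz trmx_mul !mulmxA -(mulmxA _ N^T) -(mulmxA _ _ N) NO.
rewrite /boost /D3 trmx3 !mulmx3.
by congr (M3 _ _ _ _ _ _ _ _ _); field.
Qed.

Lemma det_boost (R : realType) (c : R) : c != 0 -> \det (boost c) = 1.
Proof. by move=> c0; rewrite det_mx3; field. Qed.

Lemma col0_boost (R : realType) (N : 'M[R]_3) (c : R) :
  col 0 (N *m boost c) = col 0 N.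
Proof.
by apply/colP => i; rewrite [LHS]mxE [RHS]mxE mulmx_3E !mx3E mulr1 !mulr0 !addr0.
Qed.

(** Gauge transformation A -> B^-1 A B + B^-1 B' for B the boost by e^f, where B^-1 B' = diag(0, f',
    -f'). The exponential makes the change of w additive in f'. *)
Lemma is_derive_boost (R : realType) (N : R -> 'M[R]_3) (f : R -> R)
    (x l1 l2 w f' : R) :
  is_derive x 1 N (N x *m connection l1 l2 w) -> is_derive x 1 f f' ->
  is_derive x 1 (fun y => N y *m boost (expR (f y)))
    ((N x *m boost (expR (f x))) *m
     connection ((expR (f x))^-1 * l1) (expR (f x) * l2) (w + f')).
Proof.
move=> dN df.
have dE : is_derive x 1 (fun y => expR (f y)) (expR (f x) * f').
  exact: (@is_derive1_comp R expR f).
have e0 : expR (f x) != 0 by rewrite gt_eqF// expR_gt0.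
have dEV : is_derive x 1 (fun y => (expR (f y))^-1)
    (- (expR (f x)) ^- 2 *: (expR (f x) * f')) by exact: is_deriveV.
have c0 (c : R) : is_derive x 1 (fun=> c) 0 by exact: is_derive_cst.
have dB : is_derive x 1 (fun y => boost (expR (f y)))
   (M3 0 0 0 0 (expR (f x) * f') 0 0 0 (- (expR (f x)) ^- 2 *: (expR (f x) * f'))).
  exact: is_derive_mx3.
have := is_derive_mulmx dN dB; rewrite -!mulmxA -mulmxDr.
rewrite /boost /connection !mulmx3 addmx3 /GRing.scale/=.
suff E (A B : 'M[R]_3) : A = B ->
   is_derive x 1 (fun y => N y *m boost (expR (f y))) (N x *m A) ->
   is_derive x 1 (fun y => N y *m boost (expR (f y))) (N x *m B).
  by apply: E; congr (M3 _ _ _ _ _ _ _ _ _); field.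
by move=> ->.
Qed.

(** * Zero curvature equation and a global adapted frame *)

(** For A = N^-1 N_x and B = N^-1 N_t, equality of N_xt and N_tx gives A_t + B A = B_x + A B; the
    conclusions are its entries (1, 1), (1, 0) and (2, 0). *)
Lemma zero_curvature (R : realType) (N : R -> R -> 'M[R]_3)
    (l1 l2 w m1 m2 v : R -> R -> R) :
  smooth N -> (forall x t, lorentz (N x t)) ->
  smooth l1 -> smooth l2 -> smooth w -> smooth m1 -> smooth m2 -> smooth v ->
  has_partials N (fun x t => N x t *m connection (l1 x t) (l2 x t) (w x t))
    (fun x t => N x t *m connection (m1 x t) (m2 x t) (v x t)) ->
  forall x t,
  [/\ partial_t w x t - m1 x t * l2 x t / 2 =
      partial_x v x t - l1 x t * m2 x t / 2,
      partial_t l1 x t + v x t * l1 x t = partial_x m1 x t + w x t * m1 x t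
    & partial_t l2 x t - v x t * l2 x t = partial_x m2 x t - w x t * m2 x t].
Proof.
move=> sN NO sl1 sl2 sw sm1 sm2 sv NP x t.
have [Nx Nt] := has_partialsE NP.
have c0 (y c : R) : is_derive y 1 (fun=> c) 0 by exact: is_derive_cst.
have dN (c y : R) (f : R -> R) (f' : R) : is_derive y 1 f f' ->
    is_derive y 1 (fun z => c * f z) (c * f').
  by move=> H; exact: is_deriveZ.
have dK (f g h : R -> R) (y f' g' h' : R) : is_derive y 1 f f' ->
   is_derive y 1 g g' -> is_derive y 1 h h' ->
   is_derive y 1 (fun y => connection (f y) (g y) (h y)) (connection f' g' h').
  move=> df dg dh; apply: is_derive_mx3 => //; try exact: is_deriveN.
    by rewrite mulrC -mulNr; under eq_fun do rewrite mulrC -mulNr; exact: dN.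
  by rewrite mulrC -mulNr; under eq_fun do rewrite mulrC -mulNr; exact: dN.
have Kt : is_derive t 1 (fun t => connection (l1 x t) (l2 x t) (w x t))
    (connection (partial_t l1 x t) (partial_t l2 x t) (partial_t w x t)).
  by apply: dK; apply: (smooth_partials _ _ _).2.
have Lx : is_derive x 1 (fun x => connection (m1 x t) (m2 x t) (v x t))
    (connection (partial_x m1 x t) (partial_x m2 x t) (partial_x v x t)).
  by apply: dK; apply: (smooth_partials _ _ _).1.
have [dNx dNt] := NP x t.
have [_ dxt] := smooth_partials (smooth_partial_x sN) x t.
have [dtx _] := smooth_partials (smooth_partial_t sN) x t.
rewrite {1}Nx in dxt; rewrite {1}Nt in dtx.
have E1 := is_derive_unique dxt (is_derive_mulmx dNt Kt).
have E2 := is_derive_unique dtx (is_derive_mulmx dNx Lx).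
have := congr1 (fun F : R -> R -> 'M[R]_3 => F x t) (smooth_schwarz_mx sN).
rewrite /= E1 E2 -!mulmxA -!mulmxDr => /(congr1 (mulmx (lorentz_inv (N x t)))).
rewrite !(mulmxA _ (N x t)) lorentz_invK// !mul1mx /connection !mulmx3 !addmx3.
move=> /mx3_inj[[? ? ?] [? ? ?] [? ? ?]].
by split; lra.
Qed.

(* With v = (a, p + m, p - m) and s = 1 + m^2, the null directions orthogonal
   to v are (a m -+ p, p m +- a + s, p m +- a - s). *)
Lemma adapted_frame (R : realType) (u : R -> R -> 'cV[R]_3) : smooth u ->
  (forall x t, form21 (u x t) (u x t) = 1) ->
  exists N : R -> R -> 'M[R]_3, [/\ smooth N, forall x t, lorentz (N x t),
    forall x t, \det (N x t) = 1 & forall x t, col 0 (N x t) = u x t].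
Proof.
move=> su u1; have /smooth_mxP su' := su.
pose a x t := u x t 0 0.
pose p x t := 2^-1 * (u x t 1 0 + u x t 2 0).
pose m x t := 2^-1 * (u x t 1 0 + -1 * u x t 2 0).
pose s x t := 1 + m x t * m x t.
(* The two unscaled null vectors pair to -2 s; the factor k on the second one makes the product
   1/2. *)
pose k x t := -1 / 4 * (s x t)^-1.
(* Since s is at least 1, the division makes sense on the whole plane and the frame is global. *)
have s0 x t : s x t != 0.
  by rewrite gt_eqF// /s ltr_pwDl// -expr2 sqr_ge0.
exists (fun x t => M3
  (a x t) (a x t * m x t + -1 * p x t) (k x t * (a x t * m x t + p x t))
  (p x t + m x t) (p x t * m x t + a x t + s x t)
    (k x t * (p x t * m x t + -1 * a x t + s x t))
  (p x t + -1 * m x t) (p x t * m x t + a x t + -1 * s x t)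
    (k x t * (p x t * m x t + -1 * a x t + -1 * s x t))).
(* The unit length condition v_1^2 + v_2 v_3 = 1 in the coordinates a, p, m. *)
have H x t : a x t ^+ 2 = 1 + m x t ^+ 2 - p x t ^+ 2.
  have := u1 x t; rewrite /form21 mulmx_3E !mulmx_3E !mxE/= /a /p /m.
  rewrite ?mulr0 ?add0r ?addr0 ?mulr1 => e; lra.
have ga : smooth_gen a by exact/smooth_gen_base/su'.
have gu i : smooth_gen (fun x t => u x t i 0) by exact/smooth_gen_base/su'.
have gp : smooth_gen p.
  by apply: smooth_gen_mul; [exact: smooth_gen_cst|exact: smooth_gen_add].
have gN f : smooth_gen f -> smooth_gen (fun x t => -1 * f x t).
  by move=> gf; apply: smooth_gen_mul => //; exact: smooth_gen_cst.
have gm : smooth_gen m.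
  apply: smooth_gen_mul; first exact: smooth_gen_cst.
  by apply: smooth_gen_add => //; exact: gN.
have gs : smooth_gen s.
  apply: smooth_gen_add; first exact: smooth_gen_cst.
  exact: smooth_gen_mul.
have gk : smooth_gen k.
  apply: smooth_gen_mul; first exact: smooth_gen_cst.
  exact: smooth_gen_inv.
split.
- apply: smooth_mx3; apply: smooth_gen_smooth => //;
  do ?[exact: ga|exact: gp|exact: gm|exact: gs|exact: gk|exact: gN
    |apply: smooth_gen_add|apply: smooth_gen_mul].
- move=> x t; move: (s0 x t) (H x t); rewrite /lorentz /D3 trmx3 !mulmx3 /k /s.
  move: (a x t) (p x t) (m x t) => a' p' m' s0' H'.
  by congr (M3 _ _ _ _ _ _ _ _ _); field: H'.
- move=> x t; move: (s0 x t) (H x t); rewrite det_mx3 /k /s.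
  by move: (a x t) (p x t) (m x t) => a' p' m' s0' H'; field: H'.
- move=> x t; apply/colP; elim/ord3P; rewrite mxE mx3E /a /p /m //.
    by field.
  by field.
Qed.

(** * Null p-frames and the star operator *)

Lemma null_p_frameP (R : realType) (alpha : R -> 'cV[R]_3) (g : R -> 'M[R]_3)
    (k1 k2 : R -> R) :
  null_p_frame alpha g k1 k2 <->
  forall x, [/\ lorentz (g x), \det (g x) = 1, col 0 (g x) = derive1 alpha x
    & is_derive x 1 g (g x *m connection (k1 x) (k2 x) 0)].
Proof.
split=> H x; have := H x; rewrite /connection oppr0.
  move=> [[[gu gO] gd] gc dg ge]; split=> //.
  by apply: DeriveDef => //; rewrite -derive1E -ge mulKVmx.
move=> [gO gd gc [dg dgE]]; have [gu _] := invmx_lorentz gO.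
by split=> //; rewrite derive1E dgE mulKmx.
Qed.

(** The star operator in the basis (e_0, e_1, e_2), with the tangent vector sent to 0. *)
Definition star_mx (R : realType) : 'M[R]_3 := M3 0 0 0 0 1 0 0 0 (- 1).

Lemma star_mx_delta (R : realType) :
  [/\ star_mx R *m delta_mx 0 0 = 0 :> 'cV_3,
      star_mx R *m delta_mx 1 0 = delta_mx 1 0 :> 'cV_3
    & star_mx R *m delta_mx 2 0 = - delta_mx 2 0 :> 'cV_3].
Proof.
split; apply/colP; elim/ord3P;
  by rewrite mulmx_3E !mx3E !mxE /= ?mulr0 ?mul0r ?mulr1 ?addr0 ?add0r ?oppr0.
Qed.

Lemma colsP (R : realType) (A B : 'M[R]_3) :
  A *m delta_mx 0 0 = B *m delta_mx 0 0 :> 'cV_3 ->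
  A *m delta_mx 1 0 = B *m delta_mx 1 0 :> 'cV_3 ->
  A *m delta_mx 2 0 = B *m delta_mx 2 0 :> 'cV_3 -> A = B.
Proof.
rewrite -!colE => e0 e1 e2; apply/matrixP => i; elim/ord3P.
- by have /colP/(_ i) := e0; rewrite !mxE.
- by have /colP/(_ i) := e1; rewrite !mxE.
- by have /colP/(_ i) := e2; rewrite !mxE.
Qed.

(** A single null p-frame determines S, because its columns form a basis. *)
Lemma is_hodge_starP (R : realType) (alpha : R -> 'cV[R]_3) (x : R) S
    (g : R -> 'M[R]_3) k1 k2 :
  null_p_frame alpha g k1 k2 -> is_hodge_star alpha x S ->
  S *m g x = g x *m star_mx R.
Proof.
move=> gP [S0 /(_ _ _ _ gP)[S1 S2]].
have [J0 J1 J2] := star_mx_delta R.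
have [_ _ g0 _] := (null_p_frameP _ _ _ _).1 gP x.
apply: colsP; rewrite -!mulmxA ?J0 ?J1 ?J2 -!colE ?mulmx0 ?mulmxN -?colE //.
by rewrite g0.
Qed.

(** Boosts commute with [star_mx], so the conjugate of [star_mx] is the same for N as for a null
    p-frame obtained from N by a boost. *)
Lemma hodge_starE (R : realType) (alpha : R -> 'cV[R]_3) (N : R -> 'M[R]_3)
    (l1 l2 w : R -> R) (x : R) :
  (forall y, lorentz (N y)) -> (forall y, \det (N y) = 1) ->
  (forall y, col 0 (N y) = derive1 alpha y) ->
  (forall y : R, is_derive y 1 N (N y *m connection (l1 y) (l2 y) (w y))) ->
  continuous w ->
  hodge_star alpha x = N x *m star_mx R *m invmx (N x).
Proof.
move=> NO Nd N0 dN cw.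
(* With f' = -w the boost by e^f cancels the normal connection form. *)
have [f df] := primitive (fun y => continuousN (cw y)).
have e0 y : expR (f y) != 0 by rewrite gt_eqF// expR_gt0.
pose g y := N y *m boost (expR (f y)).
have gP : null_p_frame alpha g (fun y => (expR (f y))^-1 * l1 y)
    (fun y => expR (f y) * l2 y).
  apply/null_p_frameP => y; split.
  - exact: lorentz_boost.
  - by rewrite det_mulmx Nd det_boost// mulr1.
  - by rewrite col0_boost.
  - by have := is_derive_boost (dN y) (df y); rewrite subrr.
have boostC c : boost c *m star_mx R = star_mx R *m boost c.
  by rewrite /boost /star_mx !mulmx3; congr (M3 _ _ _ _ _ _ _ _ _); ring.
pose S := N x *m star_mx R *m invmx (N x).
have Sg c : S *m (N x *m boost c) = N x *m boost c *m star_mx R.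
  by rewrite /S -!mulmxA mulKmx ?boostC//; have [] := invmx_lorentz (NO x).
have [J0 J1 J2] := star_mx_delta R.
(* At x every null p-frame is [N x] times a boost, since the first columns agree, and [Sg] covers
   all of these. *)
have SP : is_hodge_star alpha x S.
  split=> [|g' k1' k2' /null_p_frameP/(_ x)[gO gd g0 _]].
    (* The boost by 1 brings [N x] into the shape required by [Sg]. *)
    rewrite -N0 -(col0_boost _ 1) colE mulmxA Sg -mulmxA J0.
    by rewrite mulmx0.
  have N0x : col 0 (N x) = col 0 (g' x) by rewrite N0 g0.
  have [c0 ->] := lorentz_stabilizer (NO x) gO (Nd x) gd N0x.
  by split; rewrite !colE (mulmxA S) Sg -!mulmxA ?J1 ?J2 ?mulmxN.
(* [get] returns a genuine star operator because S is one; [is_hodge_starP] then identifies the two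
   through the frame g. *)
have /(is_hodge_starP gP) E : is_hodge_star alpha x (hodge_star alpha x).
  by apply: getPex; exists S.
have := is_hodge_starP gP SP; rewrite -E => /(congr1 (mulmxr (invmx (g x)))).
have [gu _] : g x \in unitmx /\ _ := invmx_lorentz (lorentz_boost (e0 x) (NO x)).
by rewrite /= !mulmxK.
Qed.

(** * Structure equations of the adapted frame under the flow *)

Lemma lorentz_partials (R : realType) (N : R -> R -> 'M[R]_3) :
  smooth N -> (forall x t, lorentz (N x t)) ->
  exists l1 l2 w m1 m2 v : R -> R -> R,
  [/\ [/\ smooth l1, smooth l2 & smooth w], [/\ smooth m1, smooth m2 & smooth v]
  & has_partials N (fun x t => N x t *m connection (l1 x t) (l2 x t) (w x t))
    (fun x t => N x t *m connection (m1 x t) (m2 x t) (v x t))].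
Proof.
move=> sN NO.
have sA (F : R -> R -> 'M[R]_3) : smooth F ->
    smooth (fun x t => lorentz_inv (N x t) *m F x t).
  move=> sF; apply: smooth_mulmx => //; apply: smooth_mulmx; last exact: smooth_cst.
  by apply: smooth_mulmx; [exact: smooth_cst|exact: smooth_trmx].
have /smooth_mxP sAx := sA _ (smooth_partial_x sN).
have /smooth_mxP sAt := sA _ (smooth_partial_t sN).
pose A F x t : 'M[R]_3 := lorentz_inv (N x t) *m F x t.
exists (fun x t => A (partial_x N) x t 1 0), (fun x t => A (partial_x N) x t 2 0),
  (fun x t => A (partial_x N) x t 1 1), (fun x t => A (partial_t N) x t 1 0),
  (fun x t => A (partial_t N) x t 2 0), (fun x t => A (partial_t N) x t 1 1).
split; [split; exact: sAx|split; exact: sAt|].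
move=> x t; have [dx dt] := smooth_partials sN x t; split.
  rewrite -(@lorentz_connection _ (N^~ t))//.
by rewrite -(@lorentz_connection _ (N x) t).
Qed.

(** The curvature vector is l1 e_1 + l2 e_2 and the star operator changes the sign of its second
    term. The coefficient vector of the velocity is kept as the first column of a 3 x 3 matrix so
    that the lemmas on [mx3] apply to it. *)
Lemma star_MCF_velocity (R : realType) (gamma : R -> R -> 'cV[R]_3)
    (N : R -> R -> 'M[R]_3) (l1 l2 w : R -> R -> R) :
  star_MCF gamma -> (forall x t, lorentz (N x t)) ->
  (forall x t, \det (N x t) = 1) ->
  (forall x t, col 0 (N x t) = partial_x gamma x t) ->
  (forall x t : R, is_derive x 1 (N^~ t)
     (N x t *m connection (l1 x t) (l2 x t) (w x t))) ->
  (forall t, continuous (w^~ t)) ->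
  forall x t, partial_t gamma x t =
    N x t *m (M3 0 0 0 (- 2^-1 * l1 x t) 0 0 (2^-1 * l2 x t) 0 0
              *m delta_mx 0 0).
Proof.
move=> gE NO Nd N0 dN cw x t.
have [Nu _] := invmx_lorentz (NO x t).
have -> : partial_t gamma x t = - 2^-1 *: (N x t *m star_mx R *m invmx (N x t)
    *m mean_curvature (gamma^~ t) x).
  rewrite gE (_ : hodge_star _ _ = N x t *m star_mx R *m invmx (N x t))//.
  exact: (@hodge_starE _ _ (N^~ t) (l1^~ t) (l2^~ t) (w^~ t)).
have -> : mean_curvature (gamma^~ t) x =
    N x t *m connection (l1 x t) (l2 x t) (w x t) *m delta_mx 0 0.
  rewrite /mean_curvature.
  have -> : derive1 (gamma^~ t) = fun y => N y t *m delta_mx 0 0.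
    by apply/funext => y; rewrite -colE N0.
  rewrite derive1E.
  have [_ ->] := is_derive_mulmx (dN x t) (is_derive_cst (delta_mx 0 0 : 'cV_3) x 1).
  by rewrite mulmx0 addr0.
rewrite -!mulmxA mulKmx// scalemxAr; congr (_ *m _).
rewrite mulmxA scalemxAl /star_mx /connection mulmx3 scalemx3 -!colE.
by apply/colP; elim/ord3P; rewrite [LHS]mxE [RHS]mxE !mx3E; ring.
Qed.

Lemma is_derive_expR_mul (R : realType) (f l : R -> R) (x f' l' : R) :
  is_derive x 1 f f' -> is_derive x 1 l l' ->
  is_derive x 1 (fun y => expR (f y) * l y) (expR (f x) * (l' + f' * l x)).
Proof.
move=> df dl.
have dE : is_derive x 1 (fun y => expR (f y)) (expR (f x) * f').
  exact: (@is_derive1_comp R expR f).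
have := is_deriveM dE dl; rewrite /GRing.scale/=; set k := _ + _.
by have -> : expR (f x) * (l' + f' * l x) = k by rewrite /k; ring.
Qed.

Lemma is_derive_expRV_mul (R : realType) (f l : R -> R) (x f' l' : R) :
  is_derive x 1 f f' -> is_derive x 1 l l' ->
  is_derive x 1 (fun y => (expR (f y))^-1 * l y)
    ((expR (f x))^-1 * (l' - f' * l x)).
Proof.
move=> df dl; have := is_derive_expR_mul (is_deriveN df) dl.
rewrite mulNr -expRN.
by under [X in is_derive _ _ X]eq_fun do rewrite expRN.
Qed.

(** * Evolving frames: uniqueness and the second flow *)

Lemma evolving_frameP (R : realType) (gamma : R -> R -> 'cV[R]_3)
    (g : R -> R -> 'M[R]_3) (k1 k2 : R -> R -> R) :
  evolving_frame gamma g k1 k2 <->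
  [/\ forall x t, lorentz (g x t), forall x t, \det (g x t) = 1,
    forall x t, col 0 (g x t) = partial_x gamma x t
  & has_partials g (fun x t => g x t *m connection (k1 x t) (k2 x t) 0)
    (fun x t => g x t *m connection (- (partial_x k1 x t / 2))
      (partial_x k2 x t / 2) (k1 x t * k2 x t / 4))].
Proof.
have LE x t : 4^-1 *: M3 0 (- partial_x k2 x t) (partial_x k1 x t)
    (- 2 * partial_x k1 x t) (k1 x t * k2 x t) 0
    (2 * partial_x k2 x t) 0 (- (k1 x t * k2 x t)) =
    connection (- (partial_x k1 x t / 2))
      (partial_x k2 x t / 2) (k1 x t * k2 x t / 4).
  by rewrite scalemx3; congr (M3 _ _ _ _ _ _ _ _ _); field.
split=> [[H1 H2]|[gO gd g0 gP]].
  have {}H1 x t := (null_p_frameP _ _ _ _).1 (H1 t) x.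
  split=> [x t|x t|x t|x t].
  - by have [] := H1 x t.
  - by have [] := H1 x t.
  - by have [] := H1 x t.
  split; first by have [] := H1 x t.
  have [dg] := H2 x t; rewrite LE => <-; apply: DeriveDef => //.
  have [gO _ _ _] := H1 x t; have [gu _] := invmx_lorentz gO.
  by rewrite mulKVmx// /partial_t derive1E.
split=> [t|x t].
  apply/null_p_frameP => x; split=> //.
  by have [] := gP x t.
have [_ [dg dgE]] := gP x t; split=> //.
have [gu _] := invmx_lorentz (gO x t).
by rewrite LE /partial_t derive1E dgE mulKmx.
Qed.

(** M = g^-1 g' is a boost at every point. Its entries (1, 0) and (2, 0) vanish identically, and
    their x-derivatives give the relations between the curvatures; the derivatives of the entry (1,
    1) then show that the boost is constant. *)
Lemma boost_unique (R : realType) (gamma : R -> R -> 'cV[R]_3)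
    (g g' : R -> R -> 'M[R]_3) (k1 k2 k1' k2' : R -> R -> R) :
  evolving_frame gamma g k1 k2 -> evolving_frame gamma g' k1' k2' ->
  exists c : R, c != 0 /\ forall x t,
   [/\ g' x t = g x t *m boost c, k1' x t = c^-1 * k1 x t
     & k2' x t = c * k2 x t].
Proof.
move=> /evolving_frameP[gO gd g0 gP] /evolving_frameP[gO' gd' g0' gP'].
pose M x t := lorentz_inv (g x t) *m g' x t.
have st x t : M x t 1 1 != 0 /\ g' x t = g x t *m boost (M x t 1 1).
  by apply: lorentz_stabilizer; rewrite ?g0 ?g0'.
have ME x t : M x t = boost (M x t 1 1).
  have [_] := st x t; move: (M x t 1 1) => c gE.
  by rewrite /M gE mulmxA lorentz_invK ?mul1mx.
have dMx x t := is_derive_relative (fun y => gO y t) (gP x t).1 (gP' x t).1.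
have dMt x t := is_derive_relative (fun s => gO x s) (gP x t).2 (gP' x t).2.
have subE (A B : 'M[R]_3) i j : (A - B) i j = A i j - B i j by rewrite !mxE.
have entry x t := (is_derive_mxP _ _ _).1 (dMx x t).
have k1E x t : k1' x t = (M x t 1 1)^-1 * k1 x t.
  have [c0 _] := st x t.
  have := entry x t 1 0; rewrite -/(M x t).
  have -> : (fun y => (lorentz_inv (g y t) *m g' y t) 1 0) = cst 0.
    by apply/funext => y; rewrite -/(M y t) ME mx3E.
  move=> /(is_derive_unique (is_derive_cst 0 x 1)).
  rewrite {1 2}ME; move: (M x t 1 1) c0 => c c0.
  rewrite /boost /connection !mulmx3 subE !mx3E => E.
  by apply: (mulfI c0); rewrite mulVKf//; lra.
have k2E x t : k2' x t = M x t 1 1 * k2 x t.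
  have [c0 _] := st x t.
  have := entry x t 2 0; rewrite -/(M x t).
  have -> : (fun y => (lorentz_inv (g y t) *m g' y t) 2 0) = cst 0.
    by apply/funext => y; rewrite -/(M y t) ME mx3E.
  move=> /(is_derive_unique (is_derive_cst 0 x 1)).
  rewrite {1 2}ME; move: (M x t 1 1) c0 => c c0.
  rewrite /boost /connection !mulmx3 subE !mx3E => E.
  by apply: (mulfI (invr_neq0 c0)); rewrite mulKf//; lra.
have cx t x y : M x t 1 1 = M y t 1 1.
  apply: (is_derive0_const (f := fun x => M x t 1 1)) => {}x.
  have := entry x t 1 1; rewrite -/(M x t) {1 2}ME /boost /connection !mulmx3.
  by rewrite subE !mx3E; congr (is_derive _ _ _); ring.
(* The t-derivative is c (k1' k2' - k1 k2) / 4, which vanishes because the factors c^-1 and c cancel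
   in k1' k2'. *)
have ct x t s : M x t 1 1 = M x s 1 1.
  apply: (is_derive0_const (f := fun t => M x t 1 1)) => {}t.
  have := (is_derive_mxP _ _ _).1 (dMt x t) 1 1.
  rewrite -/(M x t) {1 2}ME /boost /connection !mulmx3.
  have [c0 _] := st x t.
  by rewrite subE !mx3E k1E k2E; congr (is_derive _ _ _); field.
exists (M 0 0 1 1); split=> [|x t]; first by have [] := st 0 0.
by rewrite -(cx 0 x) -(ct x t); split=> //; have [] := st x t.
Qed.

Lemma has_partialsZ (R : realType) (c : R) (f fx ft : R -> R -> R) :
  has_partials f fx ft -> has_partials (fun x t => c * f x t)
    (fun x t => c * fx x t) (fun x t => c * ft x t).
Proof. by move=> fP x t; have [? ?] := fP x t; split; exact: is_deriveZ. Qed.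

(** With w = 0 and the prescribed g^-1 g_t, the last two zero curvature equations are evolution
    equations for k1 and k2, and rescaling turns them into those of q and r. *)
Lemma evolving_second_flow (R : realType) (g : R -> R -> 'M[R]_3)
    (k1 k2 : R -> R -> R) :
  smooth g -> (forall x t, lorentz (g x t)) -> smooth k1 -> smooth k2 ->
  has_partials g (fun x t => g x t *m connection (k1 x t) (k2 x t) 0)
    (fun x t => g x t *m connection (- (partial_x k1 x t / 2))
      (partial_x k2 x t / 2) (k1 x t * k2 x t / 4)) ->
  second_flow (fun x t => - (k1 x t / 2)) (fun x t => k2 x t / 2).
Proof.
move=> sg gO sk1 sk2 gP x t.
have qE : (fun x t => - (k1 x t / 2)) = (fun x t => - 2^-1 * k1 x t).
  by apply/funext => y; apply/funext => s; rewrite mulrC mulNr.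
have rE (k : R -> R -> R) : (fun x t => k x t / 2) = (fun x t => 2^-1 * k x t).
  by apply/funext => y; apply/funext => s; rewrite mulrC.
have qxE : (fun x t => - (partial_x k1 x t / 2)) =
    (fun x t => - 2^-1 * partial_x k1 x t).
  by apply/funext => y; apply/funext => s; rewrite mulrC mulNr.
have sZ (c : R) (f : R -> R -> R) : smooth f -> smooth (fun x t => c * f x t).
  move=> sf; apply: smooth_gen_smooth.
  by apply: smooth_gen_mul; [exact: smooth_gen_cst|exact: smooth_gen_base].
have pZ (c : R) (f : R -> R -> R) : smooth f ->
    partial_x (fun x t => c * f x t) = (fun x t => c * partial_x f x t) /\
    partial_t (fun x t => c * f x t) = (fun x t => c * partial_t f x t).
  by move=> sf; exact/has_partialsE/has_partialsZ/smooth_partials.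
have sk1x := smooth_partial_x sk1; have sk2x := smooth_partial_x sk2.
have s0 : smooth (fun _ _ : R => 0 : R).
  by apply: smooth_gen_smooth; exact: smooth_gen_cst.
have s3 : smooth (fun x t => k1 x t * k2 x t / 4).
  apply: smooth_gen_smooth; apply: smooth_gen_mul; last exact: smooth_gen_cst.
  by apply: smooth_gen_mul; exact: smooth_gen_base.
have s1 : smooth (fun x t => - (partial_x k1 x t / 2)) by rewrite qxE; exact: sZ.
have s2 : smooth (fun x t => partial_x k2 x t / 2) by rewrite rE; exact: sZ.
have [_] := zero_curvature sg gO sk1 sk2 s0 s1 s2 s3 gP x t.
rewrite qE qxE !rE !(pZ _ _ sk1).1 !(pZ _ _ sk1).2 !(pZ _ _ sk2).1 !(pZ _ _ sk2).2.
rewrite !(pZ _ _ sk1x).1 !(pZ _ _ sk2x).1 => E1 E2; split; lra.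
Qed.

(** * Construction of the evolving frame by a boost of the adapted frame *)

Theorem theorem9p1 (R : realType) (gamma : R -> R -> 'cV[R]_3)
  (gamma_smooth : smooth gamma)
  (gamma_unit : forall x t,
     form21 (partial_x gamma x t) (partial_x gamma x t) = 1)
  (gamma_MCF : star_MCF gamma) :
  exists (g : R -> R -> 'M[R]_3) (k1 k2 : R -> R -> R),
    [/\ smooth g,
        evolving_frame gamma g k1 k2,
        second_flow (fun x t => - (k1 x t / 2)) (fun x t => k2 x t / 2)
      & forall (g' : R -> R -> 'M[R]_3) (k1' k2' : R -> R -> R),
          evolving_frame gamma g' k1' k2' ->
          second_flow (fun x t => - (k1' x t / 2)) (fun x t => k2' x t / 2) ->
          exists c : R, c != 0 /\
            forall x t,
              [/\ g' x t =
                    g x t *m diag_mx (\row_(i < 3) nth 0 [:: 1; c; c^-1] i),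
                  k1' x t = c^-1 * k1 x t
                & k2' x t = c * k2 x t]].
Proof.
have su := smooth_partial_x gamma_smooth.
have [N [sN NO Nd N0]] := adapted_frame su gamma_unit.
have [l1 [l2 [w [m1 [m2 [v [[sl1 sl2 sw] [sm1 sm2 sv] NP]]]]]]] :=
  lorentz_partials sN NO.
have l1P := smooth_partials sl1; have l2P := smooth_partials sl2.
have wP := smooth_partials sw; have vP := smooth_partials sv.
have cw t : continuous (w^~ t) := is_derive_continuous (fun x => (wP x t).1).
have vel := star_MCF_velocity gamma_MCF NO Nd N0 (fun x t => (NP x t).1) cw.
(* The t-derivative of gamma_x is the first column of N_t; it equals the x-derivative of the
   velocity, and the components along e_1 and e_2 give m1 and m2. *)
have mE x t : m1 x t = - 2^-1 * (partial_x l1 x t + w x t * l1 x t) /\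
    m2 x t = 2^-1 * (partial_x l2 x t - w x t * l2 x t).
  have e0 (y : R) : is_derive y 1 (fun=> delta_mx 0 0 : 'cV[R]_3) 0.
    exact: is_derive_cst.
  set G := _ /\ _.
  have := congr1 (fun F : R -> R -> 'cV[R]_3 => F x t)
    (smooth_schwarz_mx gamma_smooth).
  rewrite /= /partial_t /partial_x /= !derive1E.
  have -> : (fun s => derive1 (gamma^~ s) x) = (fun s => N x s *m delta_mx 0 0).
    by apply/funext => s; rewrite -colE N0.
  have [_ ->] := is_derive_mulmx (NP x t).2 (e0 t).
  have -> : (fun y => derive1 (gamma y) t) = (fun y => N y t *m
     (M3 0 0 0 (- 2^-1 * l1 y t) 0 0 (2^-1 * l2 y t) 0 0 *m delta_mx 0 0)).
    by apply/funext => y; rewrite -vel.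
  have c0 (y c : R) : is_derive y 1 (fun=> c) 0 by exact: is_derive_cst.
  have dW : is_derive x 1
     (fun y => M3 0 0 0 (- 2^-1 * l1 y t) 0 0 (2^-1 * l2 y t) 0 0)
     (M3 0 0 0 (- 2^-1 * partial_x l1 x t) 0 0 (2^-1 * partial_x l2 x t) 0 0).
    apply: is_derive_mx3 => //.
      by apply: is_deriveZ; have [] := l1P x t.
    by apply: is_deriveZ; have [] := l2P x t.
  have [_ ->] := is_derive_mulmx (NP x t).1 (is_derive_mulmx dW (e0 x)).
  rewrite !mulmx0 !addr0 -!mulmxA -!mulmxDr.
  have [Nu _] := invmx_lorentz (NO x t).
  move=> /(congr1 (mulmx (invmx (N x t)))); rewrite !mulKmx//.
  rewrite mulmxA -mulmxDl /connection mulmx3 addmx3 -!colE.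
  have col0E (A : 'M[R]_3) i : col 0 A i 0 = A i 0 by rewrite mxE.
  move=> /matrixP E; have := (E 1 0, E 2 0); rewrite !col0E !mx3E => -[E1 E2].
  by rewrite /G; split; lra.
(* The values required of f_x and f_t: w + f_x = 0 and v + f_t = k1 k2 / 4, where k1 k2 = l1 l2
   because boosts preserve the product. *)
pose a x t := -1 * w x t.
pose b x t := 4^-1 * (l1 x t * l2 x t) + -1 * v x t.
have sa : smooth a.
  apply: smooth_gen_smooth.
  by apply: smooth_gen_mul; [exact: smooth_gen_cst|exact: smooth_gen_base].
have sb : smooth b.
  apply: smooth_gen_smooth; apply: smooth_gen_add; apply: smooth_gen_mul;
   try exact: smooth_gen_cst; try exact: smooth_gen_base.
  by apply: smooth_gen_mul; exact: smooth_gen_base.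
(* After substituting [mE], the terms in w l1 l2 cancel from the first zero curvature equation,
   leaving v_x - w_t = (l1 l2)_x / 4. *)
have ab : partial_t a = partial_x b.
  apply/funext => x; apply/funext => t; rewrite /partial_t /partial_x !derive1E.
  have [_ dw] := wP x t; have [dv _] := vP x t.
  have [dl1 _] := l1P x t; have [dl2 _] := l2P x t.
  have [_ ->] : is_derive t 1 (a x) (-1 * partial_t w x t).
    exact: is_deriveZ.
  have [_ ->] : is_derive x 1 (b^~ t) (4^-1 * (l1 x t * partial_x l2 x t +
      l2 x t * partial_x l1 x t) + -1 * partial_x v x t).
    apply: is_deriveD; apply: is_deriveZ; exact: is_deriveM.
  have [+ _ _] := zero_curvature sN NO sl1 sl2 sw sm1 sm2 sv NP x t.
  have [-> ->] := mE x t; lra.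
have [f sf fP] := poincare sa sb ab.
pose k1 x t := (expR (f x t))^-1 * l1 x t.
pose k2 x t := expR (f x t) * l2 x t.
have gf : smooth_gen (fun x t => expR (f x t)).
  exact/smooth_gen_exp/smooth_gen_base.
have e0 x t : expR (f x t) != 0 by rewrite gt_eqF// expR_gt0.
have sk1 : smooth k1.
  apply: smooth_gen_smooth; apply: smooth_gen_mul; last exact: smooth_gen_base.
  exact: smooth_gen_inv.
have sk2 : smooth k2.
  by apply: smooth_gen_smooth; apply: smooth_gen_mul; last exact: smooth_gen_base.
(* Since f_x = -w, the expressions in [mE] become, after rescaling by the boost, -1/2 and 1/2 times
   the x-derivatives of k1 and k2. *)
have k1x x t : partial_x k1 x t =
    (expR (f x t))^-1 * (partial_x l1 x t + w x t * l1 x t).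
  rewrite /partial_x derive1E.
  have [_ ->] := is_derive_expRV_mul (fP x t).1 (l1P x t).1.
  by rewrite /a mulN1r mulNr opprK.
have k2x x t : partial_x k2 x t =
    expR (f x t) * (partial_x l2 x t - w x t * l2 x t).
  rewrite /partial_x derive1E.
  have [_ ->] := is_derive_expR_mul (fP x t).1 (l2P x t).1.
  by rewrite /a mulN1r mulNr.
pose g x t := N x t *m boost (expR (f x t)).
have sg : smooth g.
  apply: smooth_mulmx => //; apply: smooth_mx3; apply: smooth_gen_smooth => //;
    try exact: smooth_gen_cst.
  exact: smooth_gen_inv.
have gO x t : lorentz (g x t) by exact: lorentz_boost.
have gP : has_partials g (fun x t => g x t *m connection (k1 x t) (k2 x t) 0)
    (fun x t => g x t *m connection (- (partial_x k1 x t / 2))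
      (partial_x k2 x t / 2) (k1 x t * k2 x t / 4)).
  move=> x t; split.
    have := is_derive_boost (NP x t).1 (fP x t).1.
    by rewrite /a mulN1r subrr.
  have := is_derive_boost (NP x t).2 (fP x t).2.
  congr (is_derive _ _ _ (_ *m connection _ _ _)).
  - by rewrite k1x; have [-> _] := mE x t; rewrite mulrCA mulNr mulrC.
  - by rewrite k2x; have [_ ->] := mE x t; rewrite mulrCA mulrC.
  - by rewrite /b /k1 /k2; field.
have gE : evolving_frame gamma g k1 k2.
  apply/evolving_frameP; split=> // x t.
    by rewrite det_mulmx Nd det_boost// mulr1.
  by rewrite col0_boost.
exists g, k1, k2; split=> //; first exact: evolving_second_flow gP.
move=> g' k1' k2' gE' _.
have [c [c0 H]] := boost_unique gE gE'; exists c; split=> // x t.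
have [-> -> ->] := H x t; split=> //; congr (_ *m _).
by apply/matrixP; elim/ord3P; elim/ord3P; rewrite !mx3E !mxE.
Qed.
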